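(* For all integers $k\geq 2$ and all integers $s$ with $1\leq s\leq \left\lfloor \sqrt{2k+1} \right\rfloor-1$, we have $$\binom{ k - \left\lfloor \sqrt{2k+1} \right\rfloor + 2s+1}{2s} \geq \binom{ k + \left\lfloor \sqrt{2k+1} \right\rfloor - 2}{2s-1}.$$
   Context: Here $\lfloor\cdot\rfloor$ is the floor function and $\binom{a}{b}$ is the usual binomial coefficient. *)

(* Defs.v *)
From mathcomp Require Import all_boot all_order all_algebra.
From mathcomp Require Import reals.
Set Implicit Arguments.
Unset Strict Implicit.
Unset Printing Implicit Defensive.
Import Order.TTheory GRing.Theory Num.Theory.

(* The floor of the real square root of n; [Num.truncn] is the nat-valued
   floor on nonnegative reals.
   With m := floor_sqrt R (2 * k + 1) and k >= 2 one has 2 <= m <= k, so for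
   s >= 1 none of the nat subtractions k - m, k + m - 2, m - 1 and 2 * s - 1
   truncates. *)
Definition floor_sqrt (R : realType) (n : nat) : nat :=
  Num.truncn (Num.sqrt (n%:R : R))%R.

(* Main.v *)
From Stdlib Require Import NArith.
Require Import Defs.
From mathcomp Require Import all_boot all_order all_algebra.
From mathcomp Require Import reals.
From mathcomp Require Import zify ring lra.

Import Order.TTheory GRing.Theory Num.Theory.

(** Put [m := floor_sqrt R (2 * k + 1)], [p := m - 1], [c := k - m + 1] and
[n := 2 * s - 1].  The claim becomes ['C(c + 2 * p - 1, n) <= 'C(c + n + 1,
n + 1)] for odd [n < 2 * p], and [m ^ 2 <= 2 * k + 1] becomes
[p ^ 2 <= 2 * c].  With [t := 2 * p - 1 - n] the upper index on the left is
[c + t + n], so the right-hand side divided by the left-hand side is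

  (c + n + 1) / (n + 1)  *  \prod_(1 <= j <= n) (c + j) / (c + t + j).

Each factor increases with [c], so only the least admissible [c], about
[p ^ 2 / 2], matters ([bin_le_binS]).

For large [p] the first factor is of order at least [p / 4], while the product
stays bounded below: it is at least [(1 + t / (c + 1)) ^- n], and
[n * t <= p ^ 2 - p <= 2 * c] because [n + t = 2 * p - 1]; so it is at
least [exp (- 2)].  The bound [1 / 10] that suffices comes from the
arithmetic-geometric mean inequality ([expnD_le10]); it settles [36 <= p]
([bin_le_large]).

For small [p] the margin is very thin: there is equality for [p = 4], [n = 5],
the even exponent [n = 4] fails at [p = 4], and the ratio is below [1.001] for
[p = 6], [n = 7].  Hence the finitely many pairs [(p, n)] with [p < 36], at the
least [c], are verified by computation with binary integers ([bin_le_small]). *)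

(** * Monotonicity in the base point *)

(** From [c] to [c + 1] the right-hand side is multiplied by
[(c + n + 2) / (c + 1)] and the left-hand side by
[(c + t + n + 1) / (c + t + 1)]; the first of these is the larger. *)
Lemma bin_le_binS (c t n : nat) :
  'C(c + t + n, n) <= 'C(c + n.+1, n.+1) ->
  'C(c.+1 + t + n, n) <= 'C(c.+1 + n.+1, n.+1).
Proof.
move=> le_c.
have EL : (c + t).+1 * 'C(c.+1 + t + n, n) = (c + t + n).+1 * 'C(c + t + n, n).
  by rewrite -[c.+1 + t + n]/((c + t + n).+1) (mul_bin_down (c + t + n).+1);
     congr (_ * _); lia.
have ER : c.+1 * 'C(c.+1 + n.+1, n.+1) = (c + n.+1).+1 * 'C(c + n.+1, n.+1).
  by rewrite -[c.+1 + n.+1]/((c + n.+1).+1) (mul_bin_down (c + n.+1).+1);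
     congr (_ * _); lia.
have cross : c.+1 * (c + t + n).+1 <= (c + t).+1 * (c + n.+1).+1 by nia.
rewrite -(@leq_pmul2l (c.+1 * (c + t).+1)) //.
rewrite -mulnA EL mulnA [c.+1 * (c + t).+1]mulnC -[leqRHS]mulnA ER mulnA.
exact: leq_mul.
Qed.

Lemma bin_le_bin_mono (c0 c t n : nat) :
  c0 <= c -> 'C(c0 + t + n, n) <= 'C(c0 + n.+1, n.+1) ->
  'C(c + t + n, n) <= 'C(c + n.+1, n.+1).
Proof.
move=> /subnKC <- le0; elim: (c - c0) => [|d IHd]; first by rewrite addn0.
by rewrite addnS; apply: bin_le_binS.
Qed.

(** * Large parameters *)

(** Among the factors [(c + t + j) / (c + j)], [1 <= j <= n], of the quotient of
the two binomials, the one for [j = 1] is the largest. *)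
Lemma bin_ratio_le (c t n : nat) :
  'C(c + t + n, n) * c.+1 ^ n <= (c + t).+1 ^ n * 'C(c + n, n).
Proof.
elim: n => [|n IHn]; first by rewrite !bin0.
rewrite -(@leq_pmul2l n.+1) // !addnS mulnA -mul_bin_diag /=.
rewrite [leqRHS]mulnCA -mul_bin_diag /= !expnS.
have cross : (c + t + n).+1 * c.+1 <= (c + t).+1 * (c + n).+1 by nia.
have := leq_mul cross IHn; congr (_ <= _); ring.
Qed.

(** The arithmetic-geometric mean inequality for [n] copies of [x] and [q]
copies of [y]. *)
Lemma exprM_le1_of_mean1 (F : realFieldType) (x y : F) (n q : nat) :
  (0 <= x -> 0 <= y -> x *+ n + y *+ q = (n + q)%:R ->
   x ^+ n * y ^+ q <= 1)%R.
Proof.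
move=> x0 y0 mean1.
pose E (i : 'I_n + 'I_q) := if i is inl _ then x else y.
have E0 : {in predT, forall i, (0 <= E i)%R} by case.
have := (leif_AGM E0).1.
have -> : (#|{: 'I_n + 'I_q}| = n + q)%N by rewrite card_sum !card_ord.
rewrite !big_sumType /= !prodr_const !sumr_const !card_ord mean1.
have [->|nq0] := posnP (n + q); first by rewrite expr0.
by rewrite divff ?expr1n // pnatr_eq0 -lt0n.
Qed.

(** The bound is an elementary substitute for [exp 2]: by the mean inequality
[(1 + u) ^ n * (1 - n * u / 8) ^ 8 <= 1], so [(1 + u) ^ n] is at most
[(4 / 3) ^ 8 < 10]. *)
Lemma exprD1_le10 (F : realFieldType) (u : F) (n : nat) :
  (0 <= u -> n%:R * u <= 2 -> (1 + u) ^+ n <= 10%:R)%R.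
Proof.
move=> u0 nu; pose y : F := (1 - n%:R * u / 8%:R)%R.
have y34 : (3%:R / 4%:R <= y)%R by rewrite /y; lra.
have AGM : ((1 + u) ^+ n * y ^+ 8 <= 1)%R.
  apply: exprM_le1_of_mean1; [lra | lra |].
  by rewrite -(mulr_natl (1 + u)) -(mulr_natl y) natrD /y; field.
have y8 : ((3%:R / 4%:R) ^+ 8 <= y ^+ 8)%R by rewrite lerXn2r ?nnegrE //; lra.
have X0 : (0 <= (1 + u) ^+ n)%R by rewrite exprn_ge0 //; lra.
have := ler_wpM2l X0 y8; move: X0 AGM.
by move: (y ^+ 8)%R ((1 + u) ^+ n)%R => z X; lra.
Qed.

Lemma expnD_le10 (a t n : nat) :
  0 < a -> n * t <= 2 * a -> (a + t) ^ n <= 10 * a ^ n.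
Proof.
move=> a0 nt.
have a0' : (0 < a%:R :> rat)%R by rewrite ltr0n.
pose u : rat := (t%:R / a%:R)%R.
have u0 : (0 <= u)%R by rewrite divr_ge0 ?ler0n.
have nu : (n%:R * u <= 2%:R)%R.
  by rewrite /u mulrA ler_pdivrMr // -!natrM ler_nat.
rewrite -(ler_nat rat) natrM !natrX natrD.
have -> : (a%:R + t%:R = (1 + u) * a%:R :> rat)%R.
  by rewrite mulrDl mul1r divfK // gt_eqF.
by rewrite exprMn ler_wpM2r ?exprD1_le10 // exprn_ge0 // ltW.
Qed.

(** The second hypothesis says that [(c + n + 1) / (n + 1)] is at least [10],
which outweighs the bound of [expnD_le10] for the quotient of
['C(c + t + n, n)] by ['C(c + n, n)]. *)
Lemma bin_le_large (c t n : nat) :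
  n * t <= 2 * c.+1 -> 9 * n.+1 <= c ->
  'C(c + t + n, n) <= 'C(c + n.+1, n.+1).
Proof.
move=> nt nc.
rewrite -(@leq_pmul2l (c.+1 ^ n * n.+1)) ?muln_gt0 ?expn_gt0 //.
rewrite -[leqRHS]mulnA addnS -mul_bin_diag /=.
have le10 := @expnD_le10 c.+1 t n isT nt.
have n10 : 10 * n.+1 <= (c + n).+1 by lia.
apply: (@leq_trans ((c.+1 + t) ^ n * 'C(c + n, n) * n.+1)).
  by rewrite mulnAC leq_mul2r addSn [c.+1 ^ n * _]mulnC bin_ratio_le orbT.
apply: (@leq_trans (10 * c.+1 ^ n * 'C(c + n, n) * n.+1)).
  by rewrite !leq_mul2r le10 !orbT.
have := leq_mul n10 (leqnn (c.+1 ^ n * 'C(c + n, n))); congr (_ <= _); ring.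
Qed.

(** * Small parameters *)

Fixpoint ffactN (x : N) (n : nat) : N :=
  if n is n'.+1 then N.mul x (ffactN (N.pred x) n') else N.one.

Lemma ffactN_correct (x : N) (n : nat) :
  N.to_nat (ffactN x n) = (N.to_nat x) ^_ n.
Proof.
elim: n x => [|n IHn] x //.
by rewrite /= N2Nat.inj_mul IHn N2Nat.inj_pred ffactnS.
Qed.

(** The inequality ['C(x, n) <= 'C(y, n.+1)] with both sides multiplied
by [n.+1`!]. *)
Definition bin_leN (x y n : nat) : bool :=
  N.leb (N.mul (N.of_nat n.+1) (ffactN (N.of_nat x) n))
        (ffactN (N.of_nat y) n.+1).

Lemma bin_leN_sound (x y n : nat) : bin_leN x y n -> 'C(x, n) <= 'C(y, n.+1).
Proof.
move=> /N.leb_le le_xy.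
have {le_xy} : n.+1 * x ^_ n <= y ^_ n.+1.
  have /ssrnat.leP : (N.to_nat (N.of_nat n.+1 * ffactN (N.of_nat x) n)%num
                <= N.to_nat (ffactN (N.of_nat y) n.+1))%coq_nat by lia.
  by rewrite N2Nat.inj_mul multE !ffactN_correct !Nat2N.id.
by rewrite -!bin_ffact factS mulnCA leq_pmul2r // muln_gt0 fact_gt0.
Qed.

Lemma bin_le_small_check :
  all (fun p => let c := uphalf (p ^ 2) in
    all (fun s => bin_leN (c + (2 * p - 2 * s.+1) + (2 * s).+1)
                          (c + (2 * s).+2) (2 * s).+1)
        (iota 0 p)) (iota 0 36).
Proof. by vm_compute. Qed.

Lemma bin_le_small (p c s : nat) :
  p < 36 -> s < p -> p ^ 2 <= 2 * c ->
  'C(c + (2 * p - 2 * s.+1) + (2 * s).+1, (2 * s).+1)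
    <= 'C(c + (2 * s).+2, (2 * s).+2).
Proof.
move=> p36 sp pc; apply: (@bin_le_bin_mono (uphalf (p ^ 2))).
  by rewrite leq_uphalf_double -mul2n.
apply: bin_leN_sound.
have /allP/(_ p) := bin_le_small_check; rewrite mem_iota => /(_ p36).
by move=> /allP/(_ s); rewrite mem_iota => /(_ sp).
Qed.

(** * The theorem *)

Lemma bin_le_odd (p c s : nat) :
  s < p -> p ^ 2 <= 2 * c ->
  'C(c + (2 * p - 2 * s.+1) + (2 * s).+1, (2 * s).+1)
    <= 'C(c + (2 * s).+2, (2 * s).+2).
Proof.
move=> sp pc; have [p36|p36] := ltnP p 36; first exact: bin_le_small.
(* The exponent is below [2 * p], and [9 * (2 * p) <= p ^ 2 / 2 <= c]: this is
   where the threshold [36] comes from. *)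
apply: bin_le_large; last by nia.
(* The product of two integers with sum [2 * p - 1] is at most [p ^ 2 - p]. *)
have [t Dp] : exists t, p = s.+1 + t by exists (p - s.+1); rewrite subnKC.
have -> : 2 * p - 2 * s.+1 = 2 * t by lia.
by move: pc (nat_Cauchy s t).1; rewrite Dp -!mulnn; nia.
Qed.

Lemma floor_sqrt_sqr_le (R : realType) (n : nat) : floor_sqrt R n ^ 2 <= n.
Proof.
rewrite /floor_sqrt -(ler_nat R) natrX.
rewrite -[leRHS]sqr_sqrtr ?ler0n // lerXn2r ?nnegrE ?ler0n ?sqrtr_ge0 //.
by rewrite truncn_le sqrtr_ge0.
Qed.

Theorem theorem2p4 (R : realType) (k s : nat) :
  2 <= k ->
  1 <= s <= floor_sqrt R (2 * k + 1) - 1 ->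
  'C(k - floor_sqrt R (2 * k + 1) + 2 * s + 1, 2 * s)
    >= 'C(k + floor_sqrt R (2 * k + 1) - 2, 2 * s - 1).
Proof.
move=> _; have := @floor_sqrt_sqr_le R (2 * k + 1).
move: (floor_sqrt R _) => m mk /andP[s0 sm].
case: s s0 sm => // s _ sm; case: m mk sm => [|p] mk sm; first by lia.
have pk : p <= k by nia.
have kp : p < k by nia.
have := @bin_le_odd p (k - p) s; rewrite (_ : s < p); last by lia.
move=> /(_ isT); rewrite (_ : p ^ 2 <= 2 * (k - p)); last by nia.
by move=> /(_ isT); congr ('C(_, _) <= 'C(_, _)); lia.
Qed.
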